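(* Let $k\ge0$ be an integer, and let $\mathcal{I}:\mathbb{H}_k\otimes_{\mathbb{C}}\mathbb{H}_k\to W_k$ be the isomorphism of complex $\mathrm{Sp}(1)\times\mathrm{Sp}(1)$-representations which maps $|0\rangle|0\rangle$ to $\sqrt{\frac{k+1}{2\pi^2}}\,g_2^k$. Then for all $p,q\in\{0,\dots,k\}$, $$\mathcal{I}\big(|p\rangle|q\rangle\big)=\binom{k}{p}^{-1}\binom{k}{q}^{-1}\sqrt{\frac{k+1}{2\pi^2}}\;\sum_{i=0}^k\binom{k}{k-q-i,\;p-i,\;i,\;q-p+i}\,g_2^{k-q-i}\,\overline{g_2}^{\,p-i}\,g_{-1}^{\,i}\,\overline{g_1}^{\,q-p+i}.$$
   Context: Quaternions: $\mathbb{H}$ has the standard real basis $e_0=1,e_1,e_2,e_3$ with $e_1e_2=e_3$; $\mathbb{C}\subset\mathbb{H}$ via $\mathtt{i}=e_1$, and $\mathbb{H}$ is a complex vector space by left multiplication, with basis $e_0,e_2$. $\mathrm{Sp}(1)=S^3\subset\mathbb{H}$ is the group of unit quaternions. A point $x=x_0e_0+x_1e_1+x_2e_2+x_3e_3$ is written $z=(z_1,z_2)$ with $z_1=x_0+x_1\mathtt{i}$, $z_2=x_2+x_3\mathtt{i}$ (so $x=z_1+z_2e_2$). Define functions $$g_2(z)=z_2,\quad \overline{g_2}(z)=\overline{z_2},\quad g_{-1}(z)=-z_1,\quad \overline{g_1}(z)=\overline{z_1}.$$ $W_k=H^4_k\otimes_{\mathbb{R}}\mathbb{C}$ is the space of complex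 harmonic homogeneous polynomials of degree $k$ on $\mathbb{R}^4$ (regarded as functions on $S^3$), with the action of $\mathrm{Sp}(1)\times\mathrm{Sp}(1)$ given by $(\beta(s,t)f)(x)=f(t^{-1}xs)$. $\mathbb{H}_1=\mathbb{H}$ carries the complex $\mathrm{Sp}(1)$-representation $s\cdot x=xs^{-1}$; $\mathbb{H}_k$ is its $k$-fold complex symmetric tensor power with the induced representation ($\mathbb{H}_0=\mathbb{C}$ trivial). For $0\le d\le k$, $|d\rangle\in\mathbb{H}_k$ is the symmetric product (normalised symmetrisation) of $k-d$ copies of $e_0$ and $d$ copies of $e_2$, and $|p\rangle|q\rangle=|p\rangle\otimes|q\rangle$. The action $\gamma(s,t)$ of $\mathrm{Sp}(1)\times\mathrm{Sp}(1)$ on $\mathbb{H}_k\otimes_{\mathbb{C}}\mathbb{H}_k$ is by $s$ on the first factor and $t$ on the second. The representations $\gamma$ on $\mathbb{H}_k\otimes_{\mathbb{C}}\mathbb{H}_k$ and $\beta$ on $W_k$ are irreducible and isomorphic, and $\mathcal{I}$ is uniquely determined by the image of $|0\rangle|0\rangle$. The multinomial coefficient $\binom{k}{a,b,c,d}=\frac{k!}{a!\,b!\,c!\,d!}$ (for $a+b+c+d=k$) is understood to be $0$, and the corresponding summand to vanish, if any of the lower entries is negative. *)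

(* Defs.v *)
From HB Require Import structures.
From mathcomp Require Import all_boot all_order all_algebra fingroup perm.
From mathcomp Require Import boolp classical_sets functions reals trigo.
From mathcomp Require Import complex mpoly ring.

Set Implicit Arguments.
Unset Strict Implicit.
Unset Printing Implicit Defensive.

Import Order.TTheory GRing.Theory Num.Theory.

Local Open Scope ring_scope.
Local Open Scope complex_scope.

Record quat (R : Type) : Type := Quat { q0 : R; q1 : R; q2 : R; q3 : R }.

Section QuatChoice.
Variable R : choiceType.

Definition quat_prod (x : quat R) := (q0 x, q1 x, q2 x, q3 x).
Definition prod_quat (t : R * R * R * R) :=
  let: (a, b, c, d) := t in Quat a b c d.
Lemma quat_prodK : cancel quat_prod prod_quat. Proof. by case. Qed.

HB.instance Definition _ := Choice.copy (quat R) (can_type quat_prodK).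

End QuatChoice.

Section Quaternions.
Variable R : realType.
Implicit Types x y z : quat R.

Lemma quatP x y :
  [/\ q0 x = q0 y, q1 x = q1 y, q2 x = q2 y & q3 x = q3 y] -> x = y.
Proof. by case: x y => [a b c d] [a' b' c' d'] /= [-> -> -> ->]. Qed.

Definition addq x y :=
  Quat (q0 x + q0 y) (q1 x + q1 y) (q2 x + q2 y) (q3 x + q3 y).
Definition oppq x := Quat (- q0 x) (- q1 x) (- q2 x) (- q3 x).
Definition mulq x y := Quat
  (q0 x * q0 y - q1 x * q1 y - q2 x * q2 y - q3 x * q3 y)
  (q0 x * q1 y + q1 x * q0 y + q2 x * q3 y - q3 x * q2 y)
  (q0 x * q2 y - q1 x * q3 y + q2 x * q0 y + q3 x * q1 y)
  (q0 x * q3 y + q1 x * q2 y - q2 x * q1 y + q3 x * q0 y).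

Lemma addqA : associative addq.
Proof. by move=> x y z; apply: quatP; split=> /=; ring. Qed.
Lemma addqC : commutative addq.
Proof. by move=> x y; apply: quatP; split=> /=; ring. Qed.
Lemma add0q : left_id (Quat 0 0 0 0) addq.
Proof. by move=> x; apply: quatP; split=> /=; ring. Qed.
Lemma addNq : left_inverse (Quat 0 0 0 0) oppq addq.
Proof. by move=> x; apply: quatP; split=> /=; ring. Qed.

HB.instance Definition _ :=
  GRing.isZmodule.Build (quat R) addqA addqC add0q addNq.

Lemma mulqA : associative mulq.
Proof. by move=> x y z; apply: quatP; split=> /=; ring. Qed.
Lemma mul1q : left_id (Quat 1 0 0 0) mulq.
Proof. by move=> x; apply: quatP; split=> /=; ring. Qed.
Lemma mulq1 : right_id (Quat 1 0 0 0) mulq.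
Proof. by move=> x; apply: quatP; split=> /=; ring. Qed.
Lemma mulqDl : left_distributive mulq addq.
Proof. by move=> x y z; apply: quatP; split=> /=; ring. Qed.
Lemma mulqDr : right_distributive mulq addq.
Proof. by move=> x y z; apply: quatP; split=> /=; ring. Qed.
Lemma oneq_neq0 : Quat 1 0 0 0 != 0 :> quat R.
Proof. by apply/eqP => -[/eqP]; rewrite oner_eq0. Qed.

HB.instance Definition _ := GRing.Zmodule_isNzRing.Build (quat R)
  mulqA mul1q mulq1 mulqDl mulqDr oneq_neq0.

Definition e0 : quat R := Quat 1 0 0 0.
Definition e1 : quat R := Quat 0 1 0 0.
Definition e2 : quat R := Quat 0 0 1 0.
Definition e3 : quat R := Quat 0 0 0 1.

Lemma mul_e1_e2 : e1 * e2 = e3.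
Proof. by apply: quatP; split=> /=; ring. Qed.

Definition quat_of_complex (c : R[i]) : quat R :=
  let: a +i* b := c in Quat a b 0 0.

Definition scaleq (c : R[i]) x : quat R := quat_of_complex c * x.

Lemma scaleqA a b x : scaleq a (scaleq b x) = scaleq (a * b) x.
Proof. by case: a b => [? ?] [? ?]; apply: quatP; split=> /=; ring. Qed.
Lemma scale1q : left_id 1 scaleq. Proof. by move=> x; exact: mul1q. Qed.
Lemma scaleqDr : right_distributive scaleq +%R.
Proof. by move=> a x y; exact: mulqDr. Qed.
Lemma scaleqDl x : {morph scaleq^~ x : a b / a + b}.
Proof. by move=> [? ?] [? ?]; apply: quatP; split=> /=; ring. Qed.

HB.instance Definition _ := GRing.Zmodule_isLmodule.Build R[i] (quat R)
  scaleqA scale1q scaleqDr scaleqDl.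

Definition z1 x : R[i] := q0 x +i* q1 x.
Definition z2 x : R[i] := q2 x +i* q3 x.

Lemma quat_z1_z2 x : x = z1 x *: e0 + z2 x *: e2.
Proof. by apply: quatP; split=> /=; ring. Qed.

Lemma z1_linear (c : R[i]) x y : z1 (c *: x + y) = c * z1 x + z1 y.
Proof. by case: c => a b; apply/eqP; rewrite eq_complex /=; apply/andP; split; apply/eqP; ring. Qed.
Lemma z2_linear (c : R[i]) x y : z2 (c *: x + y) = c * z2 x + z2 y.
Proof. by case: c => a b; apply/eqP; rewrite eq_complex /=; apply/andP; split; apply/eqP; ring. Qed.

Definition g2 x : R[i] := z2 x.
Definition g2bar x : R[i] := (z2 x)^*.
Definition gm1 x : R[i] := - z1 x.
Definition g1bar x : R[i] := (z1 x)^*.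

Definition conjq x := Quat (q0 x) (- q1 x) (- q2 x) (- q3 x).
Definition normsq x := q0 x ^+ 2 + q1 x ^+ 2 + q2 x ^+ 2 + q3 x ^+ 2.

Lemma normsqM x y : normsq (x * y) = normsq x * normsq y.
Proof. by rewrite /normsq /=; ring. Qed.

Record Sp1 := MkSp1 { sp1_val :> quat R; _ : normsq sp1_val == 1 }.

HB.instance Definition _ := [isSub for sp1_val].
HB.instance Definition _ := [Choice of Sp1 by <:].

Fact sp1_one_subproof : normsq 1 == 1.
Proof. by rewrite /normsq /=; apply/eqP; ring. Qed.
Fact sp1_mul_subproof (s t : Sp1) : normsq (sp1_val s * sp1_val t) == 1.
Proof. by rewrite normsqM (eqP (valP s)) (eqP (valP t)) mulr1. Qed.
Fact sp1_inv_subproof (s : Sp1) : normsq (conjq s) == 1.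
Proof. by rewrite -(eqP (valP s)) /normsq /=; apply/eqP; ring. Qed.

Definition sp1_one := MkSp1 sp1_one_subproof.
Definition sp1_mul s t := MkSp1 (sp1_mul_subproof s t).
Definition sp1_inv s := MkSp1 (sp1_inv_subproof s).

Lemma sp1_mulA : associative sp1_mul.
Proof. by move=> x y z; apply: val_inj; exact: mulrA. Qed.
Lemma sp1_mul1s : left_id sp1_one sp1_mul.
Proof. by move=> x; apply: val_inj; exact: mul1r. Qed.
Lemma sp1_muls1 : right_id sp1_one sp1_mul.
Proof. by move=> x; apply: val_inj; exact: mulr1. Qed.
Lemma sp1_mulVs : left_inverse sp1_one sp1_inv sp1_mul.
Proof.
move=> [x n1]; apply: val_inj; apply: quatP.
by split=> /=; [rewrite -(eqP n1) /normsq|..]; ring.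
Qed.
Lemma sp1_mulsV : right_inverse sp1_one sp1_inv sp1_mul.
Proof.
move=> [x n1]; apply: val_inj; apply: quatP.
by split=> /=; [rewrite -(eqP n1) /normsq|..]; ring.
Qed.

HB.instance Definition _ := isGroup.Build Sp1
  sp1_mulA sp1_mul1s sp1_muls1 sp1_mulVs sp1_mulsV.

Definition act1 (s : Sp1) x : quat R := x * sp1_val (s^-1)%g.

Fact act1_linear s : linear (act1 s).
Proof. by move=> c x y; rewrite /act1 mulrDl -mulrA. Qed.

HB.instance Definition _ s :=
  GRing.isLinear.Build R[i] (quat R) (quat R) _ (act1 s) (act1_linear s).

End Quaternions.

Arguments e0 {R}. Arguments e1 {R}. Arguments e2 {R}. Arguments e3 {R}.

(** The complex tensor power of [quat R], given by coordinates in the basis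
    of the tensors [hb (w 0) (x) ... (x) hb (w (k-1))], where [w] is a word
    in [false] (standing for [e0]) and [true] (standing for [e2]). *)

Section TensorPower.
Variables (R : realType) (k : nat).
Local Notation C := R[i].
Local Notation H := (quat R).

Definition hb (b : bool) : H := if b then e2 else e0.
Definition hcoord (b : bool) (x : H) : C := if b then z2 x else z1 x.

Definition tpow := {ffun {ffun 'I_k -> bool} -> C^o}.
HB.instance Definition _ := Vector.on tpow.

Definition ptens (v : 'I_k -> H) : tpow :=
  [ffun w : {ffun 'I_k -> bool} => \prod_i hcoord (w i) (v i)].

Definition tpow_map (f : H -> H) (u : tpow) : tpow :=
  \sum_w u w *: ptens (fun i => f (hb (w i))).

Definition tpow_perm (s : 'S_k) (u : tpow) : tpow :=
  [ffun w : {ffun 'I_k -> bool} => u [ffun i => w (s i)]].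

Fact tpow_map_linear f : linear (tpow_map f).
Proof.
move=> c u v; rewrite /tpow_map scaler_sumr -big_split /=.
by apply: eq_bigr => w _; rewrite !ffunE scalerDl scalerA.
Qed.
HB.instance Definition _ f :=
  GRing.isLinear.Build C tpow tpow _ (tpow_map f) (tpow_map_linear f).

Fact tpow_perm_linear s : linear (tpow_perm s).
Proof. by move=> c u v; apply/ffunP => w; rewrite !ffunE. Qed.
HB.instance Definition _ s :=
  GRing.isLinear.Build C tpow tpow _ (tpow_perm s) (tpow_perm_linear s).

Lemma hcoord_hb b b' : hcoord b (hb b') = (b == b')%:R.
Proof. by case: b; case: b'. Qed.

Lemma hb_hcoord x : x = \sum_b hcoord b x *: hb b.
Proof. by rewrite big_bool /= addrC -quat_z1_z2. Qed.

Lemma hcoord_linear b (c : C) x y :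
  hcoord b (c *: x + y) = c * hcoord b x + hcoord b y.
Proof. by case: b; rewrite /hcoord ?z1_linear ?z2_linear. Qed.

Lemma hcoord_sum b (I : finType) (F : I -> H) :
  hcoord b (\sum_i F i) = \sum_i hcoord b (F i).
Proof.
have h0 : hcoord b 0 = 0 by case: b.
apply: (big_morph _ _ h0) => x y.
by rewrite -[x]scale1r hcoord_linear mul1r scale1r.
Qed.

Lemma hcoordZ b (c : C) x : hcoord b (c *: x) = c * hcoord b x.
Proof.
have h0 : hcoord b 0 = 0 by case: b.
by rewrite -[c *: x]addr0 hcoord_linear h0 addr0.
Qed.

Lemma tpow_basis (u : tpow) : u = \sum_w u w *: ptens (fun i => hb (w i)).
Proof.
apply/ffunP => w; rewrite sum_ffunE (bigD1 w) //= [X in _ + X]big1 ?addr0.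
  rewrite !ffunE (eq_bigr (fun=> 1)) ?big1 => [|//|i _]; last first.
    by rewrite hcoord_hb eqxx.
  by rewrite [RHS]mulr1.
move=> w' /eqP ww'; rewrite !ffunE.
have [i wi] : exists i, w i != w' i.
  apply/existsP; rewrite -negb_forall; apply/negP => /forallP e; apply: ww'.
  by apply/ffunP => i; rewrite (eqP (e i)).
by rewrite (bigD1 i) //= hcoord_hb (negPf wi) mul0r; exact: mulr0.
Qed.

Lemma tpow_map_ptens (f : {linear H -> H}) v :
  tpow_map f (ptens v) = ptens (f \o v).
Proof.
apply/ffunP => w; rewrite sum_ffunE !ffunE /=.
under [RHS]eq_bigr => i _ do
  rewrite [v i]hb_hcoord linear_sum hcoord_sum.
rewrite bigA_distr_bigA /=; apply: eq_bigr => w' _; rewrite !ffunE.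
rewrite -[LHS]/(_ * _) -big_split /=; apply: eq_bigr => i _.
by rewrite linearZ hcoordZ.
Qed.

Lemma tpow_perm_ptens s v : tpow_perm s (ptens v) = ptens (v \o (s^-1)%g).
Proof.
apply/ffunP => w; rewrite !ffunE (reindex_inj (@perm_inj _ (s^-1)%g)) /=.
by apply: eq_bigr => i _; rewrite ffunE permKV.
Qed.

Lemma tpow_map_perm f s u :
  tpow_map f (tpow_perm s u) = tpow_perm s (tpow_map f u).
Proof.
rewrite /tpow_map linear_sum /=.
pose h (w : {ffun 'I_k -> bool}) := [ffun i => w (s i)].
pose h' (w : {ffun 'I_k -> bool}) := [ffun i => w ((s^-1)%g i)].
have hK : cancel h h' by move=> w; apply/ffunP => i; rewrite !ffunE permKV.
have h'K : cancel h' h by move=> w; apply/ffunP => i; rewrite !ffunE permK.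
rewrite (reindex h') /=; last by exists h => w _.
apply: eq_bigr => w _; rewrite linearZ /= tpow_perm_ptens ffunE.
rewrite [X in u X](_ : _ = w); last by rewrite -[RHS]h'K.
by congr (_ *: _); apply/ffunP => w'; rewrite !ffunE; apply: eq_bigr => i _;
  rewrite /= ffunE.
Qed.

Definition symt : {vspace tpow} :=
  (\bigcap_(s : 'S_k) fixedSpace (linfun (tpow_perm s)))%VS.

Lemma symtP (u : tpow) : reflect (forall s, tpow_perm s u = u) (u \in symt).
Proof.
rewrite memvE; apply: (iffP subv_bigcapP) => [h s | h s _].
  by have := h s isT; rewrite -memvE => /fixedSpaceP; rewrite lfunE.
by rewrite -memvE; apply/fixedSpaceP; rewrite lfunE /= h.
Qed.

Definition Hsym := subvs_of symt.
HB.instance Definition _ := Vector.on Hsym.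

Definition symprod (v : 'I_k -> H) : tpow :=
  (k`!%:R)^-1 *: \sum_(s : 'S_k) ptens (v \o s).

Lemma symprod_symt v : symprod v \in symt.
Proof.
apply/symtP => s; rewrite linearZ linear_sum /=; congr (_ *: _).
rewrite [RHS](reindex_inj (mulgI (s^-1)%g)) /=; apply: eq_bigr => t _.
rewrite tpow_perm_ptens; congr ptens; apply/funext => i /=.
by rewrite permM.
Qed.

(** The symmetric product of [k - d] copies of [e0] and [d] copies of [e2];
    only meaningful for [d <= k]. *)
Definition ket (d : nat) : Hsym :=
  Subvs (symprod_symt (fun i : 'I_k => if (i < k - d)%N then e0 else e2)).

Fact rho_symt (s : Sp1 R) (u : Hsym) :
  tpow_map (act1 s) (vsval u) \in symt.
Proof.
by apply/symtP => t; rewrite -tpow_map_perm (symtP _ (subvsP u)).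
Qed.

Definition rho_fun (s : Sp1 R) (u : Hsym) : Hsym := Subvs (rho_symt s u).

Fact rho_linear s : linear (rho_fun s).
Proof. by move=> c u v; apply: val_inj; rewrite /= linearP. Qed.
HB.instance Definition _ s :=
  GRing.isLinear.Build C Hsym Hsym _ (rho_fun s) (rho_linear s).

Definition rho (s : Sp1 R) : 'End(Hsym) := linfun (rho_fun s).

End TensorPower.

(** The tensor product of two finite-dimensional spaces, given by the matrix
    of coordinates in the products of vectors of their bases [vbasis]. *)

Section TensorProduct.
Variables (K : fieldType) (U V : vectType K).
Local Notation bU := (vbasis {:U}).
Local Notation bV := (vbasis {:V}).

Definition tensor := 'M[K]_(\dim {:U}, \dim {:V}).
HB.instance Definition _ := Vector.on tensor.

Definition tens (u : U) (v : V) : tensor :=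
  \matrix_(i, j) (coord bU i u * coord bV j v).

Definition tens_map (f : 'End(U)) (g : 'End(V)) (m : tensor) : tensor :=
  \sum_i \sum_j m i j *: tens (f bU`_i) (g bV`_j).

Lemma tens_linearl v c u u' :
  tens (c *: u + u') v = c *: tens u v + tens u' v.
Proof. by apply/matrixP => i j; rewrite !mxE linearP /= mulrDl mulrA. Qed.

Lemma tens_linearr u c v v' :
  tens u (c *: v + v') = c *: tens u v + tens u v'.
Proof. by apply/matrixP => i j; rewrite !mxE linearP /= mulrDr mulrCA. Qed.

Lemma tens_basis (m : tensor) :
  m = \sum_i \sum_j m i j *: tens bU`_i bV`_j.
Proof.
rewrite [LHS]matrix_sum_delta; apply: eq_bigr => i _; apply: eq_bigr => j _.
congr (_ *: _); apply/matrixP => i' j'.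
rewrite !mxE !coord_free ?(basis_free (vbasisP _)) // -natrM mulnb.
by rewrite ![_ == i']eq_sym ![_ == j']eq_sym.
Qed.

Lemma tens_map_tens f g u v : tens_map f g (tens u v) = tens (f u) (g v).
Proof.
have e (T : vectType K) (h : 'End(T)) x :
    h x = \sum_i coord (vbasis {:T}) i x *: h (vbasis {:T})`_i.
  rewrite {1}(coord_basis (vbasisP _) (memvf x)) linear_sum.
  by apply: eq_bigr => i _; rewrite linearZ.
rewrite (e _ f) (e _ g); apply/matrixP => i j.
rewrite /tens_map summxE !mxE !linear_sum mulr_suml /=.
apply: eq_bigr => i' _; rewrite summxE mulr_sumr.
by apply: eq_bigr => j' _; rewrite !mxE !linearZ /= mulrACA.
Qed.

End TensorProduct.

Section Representations.
Variables (R : realType) (k : nat).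
Local Notation C := R[i].

Definition gamma (s t : Sp1 R) (u : tensor (Hsym R k) (Hsym R k)) :
  tensor (Hsym R k) (Hsym R k) := tens_map (rho k s) (rho k t) u.

Definition laplacian (p : {mpoly C[4]}) : {mpoly C[4]} :=
  \sum_(i < 4) p^`M(i)^`M(i).

Definition qeval (p : {mpoly C[4]}) (x : quat R) : C :=
  p.@[tnth [tuple (q0 x)%:C; (q1 x)%:C; (q2 x)%:C; (q3 x)%:C]].

Definition W : set (Sp1 R -> C^o) :=
  [set f | exists p : {mpoly C[4]},
    [/\ p \is k.-homog, laplacian p = 0 & forall x : Sp1 R, f x = qeval p x]].

Definition beta (s t : Sp1 R) (f : Sp1 R -> C^o) : Sp1 R -> C^o :=
  fun x => f (t^-1 * x * s)%g.

Definition is_rep_iso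
    (I : tensor (Hsym R k) (Hsym R k) -> (Sp1 R -> C^o)) : Prop :=
  [/\ linear I, set_bij setT W I
    & forall s t u, I (gamma s t u) = beta s t (I u)].

End Representations.

(** The lower entries are integers, so that a formula containing them can be
    written without truncated subtraction; powers with the same (possibly
    negative) integer exponents are then multiplied by 0. *)
Definition multinomial4 (K : fieldType) (k : nat) (a b c d : int) : K :=
  if [&& 0 <= a, 0 <= b, 0 <= c & 0 <= d]
  then k`!%:R / ((absz a)`! * (absz b)`! * (absz c)`! * (absz d)`!)%N%:R else 0.

Definition norm_const (R : realType) (k : nat) : R[i] :=
  (Num.sqrt (k.+1%:R / (2 * pi ^+ 2)))%:C.

(* Main.v *)
Require Import Defs.
From HB Require Import structures.
From mathcomp Require Import all_boot all_order all_algebra fingroup perm.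
From mathcomp Require Import boolp classical_sets functions reals trigo.
From mathcomp Require Import complex ring zify.
Import Order.TTheory GRing.Theory Num.Theory.
Local Open Scope ring_scope.

(** The map [I] is known on the orbit of [|0>|0>], and that orbit already
    determines its value on every [|p>|q>].

    If a unit quaternion [s] sends [e0] to [a e0 + b e2], then on symmetric
    tensors it sends [|0>], the k-th power of [e0], to the k-th power of
    [a e0 + b e2], which is [\sum_d C(k,d) a^(k-d) b^d |d>] by the binomial
    theorem in the symmetric algebra ([val_power_vec], [rho_ket0]).  If [t]
    sends [e0] to [a' e0 + b' e2], equivariance says that [I] maps the tensor
    product of these two powers to the function
    [x |-> N g_2(t^-1 x s)^k], and a quaternion multiplication
    ([g2_sandwich]) gives
    [[
      g_2(t^-1 x s) = a a' g_2 + b a' g_{-1} + a b' \bar g_1 + b b' \bar g_2.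
    ]]
    Both sides are homogeneous of degree k in [(a, b)] and in [(a', b')].  For
    real [u] some unit quaternion realises a ratio [(a : b) = (1 : u)]
    ([exists_Sp1_ratio]), so normalising to [a = a' = 1], [b = u], [b' = v]
    yields, for all real [u] and [v] ([image_power_vec]),
    [[
      \sum_(p,q) C(k,p) C(k,q) u^p v^q I(|p>|q>)
        = N (g_2 + u g_{-1} + v \bar g_1 + u v \bar g_2)^k.
    ]]
    At each point [x] this is an identity of polynomials in [u] and [v];
    comparing coefficients of [u^p v^q] ([coef_from_nat_values], once in each
    variable) and expanding the right-hand side ([coef_two_linear_powers])
    gives the formula. *)

(** * Polynomials and their coefficients *)

Lemma poly_eq_on_nat (F : numDomainType) (p q : {poly F}) :
  (forall m : nat, p.[m%:R] = q.[m%:R]) -> p = q.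
Proof.
move=> pq; apply/eqP; rewrite -subr_eq0; apply/eqP.
apply: (@roots_geq_poly_eq0 _ _ [seq m%:R | m <- iota 0 (size (p - q))]).
- by apply/allP => _ /mapP[m _ ->]; rewrite /root !hornerE pq subrr.
- by rewrite map_inj_uniq ?iota_uniq // => m n /eqP; rewrite eqr_nat => /eqP.
- by rewrite size_map size_iota.
Qed.

(** The values at natural numbers determine coefficients in characteristic 0.
    The polynomial [p] may be given in any form, with no bound on its
    degree. *)
Lemma coef_from_nat_values (F : numDomainType) (n : nat) (c : nat -> F)
    (p : {poly F}) :
  (forall m : nat, \sum_(j < n) c j * m%:R ^+ j = p.[m%:R]) ->
  forall j, (j < n)%N -> c j = p`_j.
Proof.
move=> cp j jn; have <- : \poly_(i < n) c i = p.
  by apply: poly_eq_on_nat => m; rewrite horner_poly cp.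
by rewrite coef_poly jn.
Qed.

Lemma coef_linear_expn (F : comNzRingType) (a b : F) (n j : nat) :
  ((a%:P + b *: 'X) ^+ n)`_j = 'C(n, j)%:R * (a ^+ (n - j) * b ^+ j).
Proof.
rewrite exprDn coef_sum.
under eq_bigr => i _.
  rewrite exprZn -rmorphXn -scalerAr coefMn coefZ coefCM coefXn.
  over.
have [jn|nj] := leqP j n.
  rewrite (bigD1 (Ordinal (jn : (j < n.+1)%N))) //= eqxx big1 => [|i ij].
    by rewrite addr0 mulr1 mulr_natl mulrC.
  rewrite (_ : (j == i :> nat) = false) ?mul0r ?mulr0 ?mul0rn //.
  by apply: contraNF ij => /eqP e; apply/eqP/val_inj.
rewrite bin_small // mul0r big1 // => i _.
by rewrite gtn_eqF ?(leq_trans (ltn_ord i)) ?mul0r ?mulr0 ?mul0rn.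
Qed.

(** Splitting a k-element set into blocks of sizes [a], [b], [c], [d] may be
    done in two stages, first into blocks of sizes [a + d] and [b + c],
    each of which is then split in two. *)
Lemma multinomial4_bin (K : numFieldType) (a b c d : nat) :
  multinomial4 K (a + b + c + d) a b c d =
  ('C(a + b + c + d, b + c) * 'C(b + c, c) * 'C(a + d, d))%N%:R.
Proof.
rewrite /multinomial4 /=.
set m := (_ * _ * _ * _)%N.
have m0 : m%:R != 0 :> K by rewrite pnatr_eq0 -lt0n !muln_gt0 !fact_gt0.
apply: (mulIf m0); rewrite divfK // -natrM; congr (_%:R); rewrite /m.
have h1 := bin_fact (_ : (b + c <= a + b + c + d)%N).
rewrite -h1; last lia.
have -> : (a + b + c + d - (b + c) = a + d)%N by lia.
rewrite -(bin_fact (leq_addl b c)) -(bin_fact (leq_addl a d)) !addnK.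
by ring.
Qed.

(** The left-hand side is the coefficient of [u^p v^q] in
    [(A + D v + u (C + B v))^k].  On the right [i] counts the factors [C], so
    that [p - i] factors [B] and [q - (p - i)] factors [D] remain; the indices
    [i] for which one of these counts is negative contribute nothing to the
    expansion, as the vanishing convention for [multinomial4] requires. *)
Lemma coef_two_linear_powers (K : numFieldType) (A B C D : K) (k p q : nat) :
  (p <= k)%N -> (q <= k)%N ->
  'C(k, p)%:R * ((A%:P + D *: 'X) ^+ (k - p) * (C%:P + B *: 'X) ^+ p)`_q =
  \sum_(i < k.+1)
    multinomial4 K k (k%:Z - q%:Z - i%:Z) (p%:Z - i%:Z) i%:Z
                     (q%:Z - p%:Z + i%:Z) *
    (A ^ (k%:Z - q%:Z - i%:Z) * B ^ (p%:Z - i%:Z) * C ^ i%:Z *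
     D ^ (q%:Z - p%:Z + i%:Z)).
Proof.
move=> pk qk.
rewrite [C%:P + _]addrC (exprDn (B *: 'X)) mulr_sumr coef_sum mulr_sumr.
rewrite (big_ord_widen k.+1 (fun i => 'C(k, p)%:R *
  ((A%:P + D *: 'X) ^+ (k - p) *
   ((B *: 'X) ^+ (p - i) * C%:P ^+ i *+ 'C(p, i)))`_q)) //.
rewrite big_mkcond; apply: eq_bigr => i _; case: ltnP => ip; last first.
  rewrite /multinomial4 (_ : (0 <= p%:Z - i%:Z) = false); last lia.
  by rewrite andbF mul0r.
set P := _ ^+ (k - p).
have -> : P * ((B *: 'X) ^+ (p - i) * C%:P ^+ i *+ 'C(p, i)) =
    ('C(p, i)%:R * B ^+ (p - i) * C ^+ i) *: (P * 'X^(p - i)).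
  rewrite exprZn -mulr_natl -[_ *: 'X^_]mul_polyC -[RHS]mul_polyC.
  by rewrite !polyCM polyC_natr !polyC_exp; ring.
rewrite coefZ coefMXn coef_linear_expn.
case: ltnP => qpi.
  rewrite /multinomial4 (_ : (0 <= q%:Z - p%:Z + i%:Z) = false); last lia.
  by rewrite !andbF !(mul0r, mulr0).
have [kqi|kqi] := ltnP k (q + i).
  rewrite /multinomial4 (_ : (0 <= k%:Z - q%:Z - i%:Z) = false); last lia.
  rewrite (_ : 'C(k - p, q - (p - i)) = 0%N) ?(mul0r, mulr0) //.
  by apply: bin_small; lia.
pose a := (k - q - i)%N; pose b := (p - i)%N; pose d := (q + i - p)%N.
rewrite (_ : k%:Z - q%:Z - i%:Z = a); last by rewrite /a; lia.
rewrite (_ : p%:Z - i%:Z = b); last by rewrite /b; lia.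
rewrite (_ : q%:Z - p%:Z + i%:Z = d); last by rewrite /d; lia.
rewrite -!exprnP.
have ek : k = (a + b + i + d)%N by rewrite /a /b /d; lia.
rewrite [in multinomial4 _ _]ek multinomial4_bin.
have ep : (b + i = p)%N by rewrite /b; lia.
have ekp : (k - p = a + d)%N by rewrite /a /d; lia.
have eqi : (q - (p - i) = d)%N by rewrite /d; lia.
by rewrite ekp eqi addnK ep -ek -/b !natrM; ring.
Qed.

(** * Linear maps and scalars *)

Lemma linear_prop_sum (K : nzRingType) (V W : lmodType K) (L : V -> W) :
  linear L -> forall (J : finType) (c : J -> K) (v : J -> V),
  L (\sum_j c j *: v j) = \sum_j c j *: L (v j).
Proof.
move=> Llin J c v.
pose L' : {linear V -> W} := HB.pack L (GRing.isLinear.Build _ _ _ _ L Llin).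
rewrite -[L]/(L' : V -> W) linear_sum.
by apply: eq_bigr => j _; rewrite linearZ.
Qed.

Lemma linear_propZ (K : nzRingType) (V W : lmodType K) (L : V -> W) :
  linear L -> forall (a : K) (v : V), L (a *: v) = a *: L v.
Proof.
move=> Llin a v.
pose L' : {linear V -> W} := HB.pack L (GRing.isLinear.Build _ _ _ _ L Llin).
by rewrite -[L]/(L' : V -> W) linearZ.
Qed.

Lemma scaled_sum_linear (K : comNzRingType) (V W : lmodType K) (J : finType)
    (a : K) (f : J -> {linear V -> W}) :
  linear (fun u => a *: \sum_j f j u).
Proof.
move=> c u v; under eq_bigr => j _ do rewrite linearP.
by rewrite big_split /= -scaler_sumr scalerDr !scalerA mulrC.
Qed.

Lemma scale_invnK (K : unitRingType) (V : lmodType K) (n : nat) (u : V) :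
  n%:R \is a @GRing.unit K -> n%:R^-1 *: (u *+ n) = u.
Proof. by move=> nu; rewrite -scaler_nat scalerA mulVr ?scale1r. Qed.

Lemma scale_natl (K : nzRingType) (V : lmodType K) (n : nat) (a : K) (u : V) :
  (n%:R * a) *: u = a *: u *+ n.
Proof. by rewrite -scalerA scaler_nat. Qed.

(** * Powers of vectors in the symmetric tensor power *)

Section SymmetricPower.
Variables (R : realType) (k : nat).
Local Notation C := R[i].
Local Notation word := {ffun 'I_k -> bool}.

Definition weight (w : word) : nat := #|[set i | w i]|.

(** The word of the tensor that [ket] symmetrises. *)
Definition sorted_word (d : nat) : word := [ffun i : 'I_k => (k - d <= i)%N].

Lemma weight_le w : (weight w <= k)%N.
Proof. by rewrite -[X in (_ <= X)%N](card_ord k) max_card. Qed.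

Lemma card_weight d : #|[set w : word | weight w == d]| = 'C(k, d).
Proof.
rewrite -[in RHS](card_ord k) -card_draws.
rewrite -(card_imset _ (f := fun w : word => [set i | w i])); last first.
  by move=> w w' /setP e; apply/ffunP => i; have := e i; rewrite !inE.
apply: eq_card => A; rewrite inE; apply/imsetP/eqP => [[w + ->]|<-].
  by rewrite inE => /eqP.
exists [ffun i => i \in A].
  by rewrite inE /weight; apply/eqP/eq_card => i; rewrite inE ffunE.
by apply/setP => i; rewrite inE ffunE.
Qed.

Lemma weight_sorted d : (d <= k)%N -> weight (sorted_word d) = d.
Proof.
move=> dk; rewrite /weight cardsE cardE size_filter.
have -> : count [pred i | sorted_word d i] (Finite.enum 'I_k) =
    count (leq (k - d)) (iota 0 (k - d + d)).
  rewrite subnK // -val_enum_ord count_map enumT.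
  by apply: eq_count => i; rewrite /= ffunE.
rewrite iotaD count_cat add0n.
rewrite (_ : count _ (iota 0 _) = 0%N) ?add0n; last first.
  apply/eqP; rewrite -leqn0 leqNgt -has_count -all_predC; apply/allP => i.
  by rewrite mem_iota /= -ltnNge.
apply/eqP; rewrite -[X in _ == X](size_iota (k - d)) -all_count.
by apply/allP => i; rewrite mem_iota => /andP[].
Qed.

(** The symmetric group acts transitively on the words of a given weight;
    hence the basis tensors of weight [d] all have the symmetrisation
    [|d>]. *)
Lemma same_weight_perm (w w' : word) : weight w = weight w' ->
  exists s : 'S_k, forall i, w i = w' (s i).
Proof.
move=> ww'; pose t (f : word) := [tuple f i | i < k].
have cnt f : count_mem true (t f) = weight f.
  rewrite /weight cardsE cardE size_filter count_map -enumT.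
  by apply: eq_count => i; rewrite /= eqb_id.
have /tuple_permP[s e] : perm_eq (t w) (t w').
  apply/allP => -[] _ /=; rewrite ?cnt ?ww' //.
  have cN f : count_mem false (t f) = (k - weight f)%N.
    rewrite -cnt -[X in (X - _)%N](size_tuple (t f)).
    by rewrite -(count_predC (pred1 true)) addKn; apply: eq_count => -[].
  by rewrite !cN ww'.
exists s => i; have := congr1 (nth false ^~ i) e.
by rewrite -!tnth_nth !tnth_mktuple.
Qed.

Definition symmetrise (u : tpow R k) : tpow R k :=
  (k`!%:R)^-1 *: \sum_(s : 'S_k) tpow_perm s u.

Lemma symmetrise_linear : linear symmetrise.
Proof.
exact: (@scaled_sum_linear C (tpow R k) (tpow R k) 'S_k _ (@tpow_perm R k)).
Qed.

Lemma symmetrise_id (u : tpow R k) :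
  (forall s : 'S_k, tpow_perm s u = u) -> symmetrise u = u.
Proof.
move=> us; rewrite /symmetrise (eq_bigr (fun=> u)) // sumr_const card_Sn.
by apply: scale_invnK; rewrite unitfE pnatr_eq0 -lt0n fact_gt0.
Qed.

Lemma symmetrise_ptens (v : 'I_k -> quat R) :
  symmetrise (ptens v) = symprod v.
Proof.
rewrite /symmetrise /symprod (reindex_inj invg_inj) /=; congr (_ *: _).
by apply: eq_bigr => s _; rewrite tpow_perm_ptens invgK.
Qed.

Lemma symprod_perm (v : 'I_k -> quat R) (s : 'S_k) :
  symprod (v \o s) = symprod v.
Proof.
rewrite /symprod; congr (_ *: _).
rewrite [RHS](reindex_inj (mulIg s)) /=; apply: eq_bigr => t _.
by congr ptens; apply/funext => i /=; rewrite permM.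
Qed.

Lemma val_ket d : vsval (ket R k d) = symprod (fun i => hb R (sorted_word d i)).
Proof.
apply: (congr1 (@symprod R k)); apply/funext => i.
by rewrite ffunE /hb (ltnNge i); case: (_ <= _)%N.
Qed.

Lemma symprod_word (w : word) :
  symprod (fun i => hb R (w i)) = vsval (ket R k (weight w)).
Proof.
have [s ws] := same_weight_perm _ _ (esym (weight_sorted _ (weight_le w))).
rewrite val_ket -[RHS](symprod_perm _ s).
by apply: (congr1 (@symprod R k)); apply/funext => i /=; rewrite ws.
Qed.

Lemma prod_word (K : comNzRingType) (a b : K) (w : word) :
  \prod_i (if w i then b else a) = a ^+ (k - weight w) * b ^+ weight w.
Proof.
rewrite (bigID w) /= mulrC.
rewrite (eq_bigr (fun=> a)); last by move=> i /negPf ->.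
rewrite [X in _ * X](eq_bigr (fun=> b)); last by move=> i ->.
rewrite !prodr_const; congr (_ ^+ _ * _ ^+ _); last by rewrite /weight cardsE.
rewrite /weight cardsE -[X in (X - _)%N](card_ord k) -(cardC w) addKn.
by apply: eq_card => i; rewrite !inE.
Qed.

(** The binomial expansion of the k-th symmetric power of
    [a *: e0 + b *: e2]; see [val_power_vec]. *)
Definition power_vec (a b : C) : Hsym R k :=
  \sum_(d < k.+1) ('C(k, d)%:R * (a ^+ (k - d) * b ^+ d)) *: ket R k d.

(** A pure power is its own symmetrisation.  Symmetrising its expansion in
    basis tensors term by term turns each word of weight [d] into [|d>] with
    coefficient [a^(k-d) b^d], and there are [C(k,d)] such words. *)
Lemma val_power_vec (a b : C) :
  vsval (power_vec a b) = ptens (fun=> a *: e0 + b *: e2).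
Proof.
set x := a *: e0 + b *: e2.
have hx c : hcoord c x = if c then b else a.
  rewrite /x -[e0]/(hb R false) -[e2]/(hb R true) hcoord_linear hcoordZ.
  by rewrite !hcoord_hb; case: c; rewrite ?mulr1 ?mulr0 ?addr0 ?add0r.
rewrite -[RHS]symmetrise_id; last by move=> s; rewrite tpow_perm_ptens.
rewrite [X in symmetrise X]tpow_basis.
rewrite (linear_prop_sum _ _ _ _ symmetrise_linear).
rewrite /power_vec.
rewrite (linear_prop_sum _ _ _ (@vsval _ _ (symt R k)) (linearP _)).
rewrite (partition_big (fun w : word => inord (weight w) : 'I_k.+1) predT) //=.
apply: eq_bigr => d _.
rewrite (eq_bigl (fun w => w \in [set w | weight w == d])); last first.
  by move=> w; rewrite inE -(inj_eq val_inj) /= inordK // ltnS weight_le.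
rewrite (eq_bigr (fun=> (a ^+ (k - d) * b ^+ d) *: vsval (ket R k d))).
  by rewrite sumr_const card_weight; exact: scale_natl.
move=> w; rewrite inE => /eqP wd.
rewrite symmetrise_ptens symprod_word wd ffunE.
by rewrite -wd -prod_word; congr (_ *: _); apply: eq_bigr => i _; rewrite hx.
Qed.

Lemma power_vecZ (r a b : C) :
  power_vec (r * a) (r * b) = r ^+ k *: power_vec a b.
Proof.
rewrite /power_vec scaler_sumr; apply: eq_bigr => d _; rewrite scalerA.
congr (_ *: _); rewrite !exprMn mulrACA -exprD subnK; last by rewrite -ltnS.
exact: mulrCA.
Qed.

Lemma ket0E : ket R k 0 = power_vec 1 0.
Proof.
rewrite /power_vec big_ord_recl big1 ?addr0.
  by rewrite bin0 expr1n !mul1r scale1r.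
by move=> i _; rewrite /= expr0n /= !mulr0 scale0r.
Qed.

(** [|0>] is a pure power of [e0], and the action on tensors is diagonal, so
    its orbit consists of pure powers. *)
Lemma rho_ket0 (s : Sp1 R) :
  rho k s (ket R k 0) = power_vec (z1 (act1 s e0)) (z2 (act1 s e0)).
Proof.
rewrite ket0E /rho lfunE; apply: val_inj.
rewrite [RHS]val_power_vec [LHS]/= val_power_vec tpow_map_ptens.
congr ptens; apply/funext => i /=.
by rewrite scale0r addr0 scale1r -quat_z1_z2.
Qed.

End SymmetricPower.

(** * The orbit of the generating vector *)

Section OrbitImage.
Variable R : realType.
Local Open Scope complex_scope.

(** The signs encode that [s] is the conjugate of [a + b e2], so that
    [s] acts on [e0] by sending it to [a e0 + b e2]; likewise for [t]. *)
Lemma g2_sandwich (s t x : Sp1 R) (a b a' b' : R) :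
  sp1_val s = Quat a 0 (- b) 0 -> sp1_val t = Quat a' 0 (- b') 0 ->
  g2 (t^-1 * x * s)%g =
  a%:C * a'%:C * g2 x + b%:C * a'%:C * gm1 x +
  (a%:C * b'%:C * g1bar x + b%:C * b'%:C * g2bar x).
Proof.
move=> es et.
have -> : sp1_val (t^-1 * x * s)%g =
    Quat a' 0 b' 0 * x * Quat a 0 (- b) 0.
  by rewrite -es; congr (_ * _ * _); rewrite /= et /conjq /= opprK oppr0.
case: (sp1_val x) => x0 x1 x2 x3.
apply/eqP; rewrite eq_complex /=; apply/andP; split; apply/eqP; ring.
Qed.

Lemma act1_e0 (s : Sp1 R) (a b : R) :
  sp1_val s = Quat a 0 (- b) 0 -> act1 s e0 = Quat a 0 b 0.
Proof.
by move=> es; rewrite /act1 /= es; apply: quatP; split => /=; ring.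
Qed.

(** In the shape that [act1_e0] needs: this [s] sends [e0] to the multiple
    [r] of [e0 + u e2], with [r = (1 + u^2)^(-1/2)]. *)
Lemma exists_Sp1_ratio (u : R) : exists (s : Sp1 R) (r : R),
  r != 0 /\ sp1_val s = Quat r 0 (- (r * u)) 0.
Proof.
pose d := 1 + u ^+ 2; have d0 : 0 < d by rewrite ltr_pwDl ?ltr01 ?sqr_ge0.
have e : normsq (Quat (Num.sqrt d)^-1 0 (- ((Num.sqrt d)^-1 * u)) 0) == 1.
  apply/eqP; rewrite /normsq /= sqrrN exprMn exprVn sqr_sqrtr ?ltW //.
  by rewrite expr0n /= !addr0 -{1}[d^-1]mulr1 -mulrDr mulVf ?gt_eqF.
exists (MkSp1 e), (Num.sqrt d)^-1; split=> //.
by rewrite invr_eq0 gt_eqF // sqrtr_gt0.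
Qed.

Variable k : nat.

Lemma tensZZ (a b : R[i]) (u v : Hsym R k) :
  tens (a *: u) (b *: v) = (a * b) *: tens u v.
Proof. by apply/matrixP => i j; rewrite !mxE !linearZ mulrACA. Qed.

(** Equivariance gives this up to scalars: the unit quaternions chosen send
    [e0] to [r (e0 + u e2)] and [r' (e0 + v e2)], and by homogeneity both sides
    carry the same factor [(r r')^k], which cancels. *)
Lemma image_power_vec
    (I : tensor (Hsym R k) (Hsym R k) -> (Sp1 R -> R[i]^o)) (N : R[i])
    (I_iso : is_rep_iso I)
    (I_00 : I (tens (ket R k 0) (ket R k 0)) =
            (fun x : Sp1 R => N * g2 x ^+ k))
    (u v : R) (x : Sp1 R) :
  I (tens (power_vec R k 1 u%:C) (power_vec R k 1 v%:C)) x =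
  N * (g2 x + u%:C * gm1 x + (v%:C * g1bar x + u%:C * v%:C * g2bar x)) ^+ k.
Proof.
have [Ilin _ Iequiv] := I_iso.
have [s [r [r0 es]]] := exists_Sp1_ratio u.
have [t [r' [r'0 et]]] := exists_Sp1_ratio v.
have rC (y : R) : y != 0 -> y%:C != 0.
  by move=> y0; rewrite (fmorph_eq0 (real_complex R)).
have vecE (s0 : Sp1 R) (y w : R) : sp1_val s0 = Quat y 0 (- (y * w)) 0 ->
    rho k s0 (ket R k 0) = (y%:C ^+ k) *: power_vec R k 1 w%:C.
  move=> e; rewrite rho_ket0 (act1_e0 _ _ _ e) -power_vecZ mulr1.
  by rewrite -(rmorphM (real_complex R)).
have := congr1 (fun f => f x) (Iequiv s t (tens (ket R k 0) (ket R k 0))).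
rewrite /gamma tens_map_tens (vecE _ _ _ es) (vecE _ _ _ et) tensZZ.
rewrite (linear_propZ _ _ _ _ Ilin).
rewrite /beta I_00 (g2_sandwich _ _ _ _ _ _ _ es et).
rewrite -[LHS]/(_ * _) -exprMn => e.
have nz : (r%:C * r'%:C) ^+ k != 0 by rewrite expf_neq0 // mulf_neq0 ?rC.
apply: (mulfI nz); rewrite e mulrCA -exprMn.
congr (_ * _ ^+ _); rewrite !(rmorphM (real_complex R)); ring.
Qed.

End OrbitImage.

(** * Comparison of coefficients *)

Lemma image_tens_power_vec (R : realType) (k : nat)
    (L : tensor (Hsym R k) (Hsym R k) -> R[i]^o) (u v : R[i]) :
  linear L ->
  L (tens (power_vec R k 1 u) (power_vec R k 1 v)) =
  \sum_(p < k.+1) ('C(k, p)%:R *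
    \sum_(q < k.+1) 'C(k, q)%:R * L (tens (ket R k p) (ket R k q)) * v ^+ q) *
    u ^+ p.
Proof.
move=> Llin; rewrite /power_vec.
rewrite (linear_prop_sum _ _ _ _ (fun c x y => tens_linearl _ c x y)).
rewrite (linear_prop_sum _ _ _ _ Llin); apply: eq_bigr => p _.
rewrite (linear_prop_sum _ _ _ _ (fun c x y => tens_linearr _ c x y)).
rewrite (linear_prop_sum _ _ _ _ Llin) expr1n mul1r mulrAC.
by congr (_ * _); apply: eq_bigr => q _; rewrite expr1n mul1r mulrAC.
Qed.

Theorem theorem7p4 (R : realType) (k : nat)
  (I : tensor (Hsym R k) (Hsym R k) -> (Sp1 R -> R[i]^o))
  (I_iso : is_rep_iso I)
  (I_00 : I (tens (ket R k 0) (ket R k 0)) =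
          (fun x : Sp1 R => norm_const R k * g2 x ^+ k))
  (p q : nat) (p_le_k : (p <= k)%N) (q_le_k : (q <= k)%N) :
  I (tens (ket R k p) (ket R k q)) =
  (fun x : Sp1 R =>
     'C(k, p)%:R^-1 * 'C(k, q)%:R^-1 * norm_const R k *
     \sum_(i < k.+1)
       multinomial4 R[i] k (k%:Z - q%:Z - i%:Z) (p%:Z - i%:Z) i%:Z
                           (q%:Z - p%:Z + i%:Z) *
       (g2 x ^ (k%:Z - q%:Z - i%:Z) * g2bar x ^ (p%:Z - i%:Z) *
        gm1 x ^ i%:Z * g1bar x ^ (q%:Z - p%:Z + i%:Z))).
Proof.
apply/funext => x; have [Ilin _ _] := I_iso.
pose L u := I u x; have Llin : linear L by move=> c u v; rewrite /L Ilin.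
set N := norm_const R k in I_00 *.
pose c p q := L (tens (ket R k p) (ket R k q)).
(* First compare coefficients in [u], keeping [v] at a natural number [n]:
   what remains is an identity in [v] alone for each exponent of [u]. *)
have rowE (n : nat) p' : (p' < k.+1)%N ->
    'C(k, p')%:R * (\sum_(q' < k.+1) 'C(k, q')%:R * c p' q' * n%:R ^+ q') =
    N * ('C(k, p')%:R * ((g2 x + n%:R * g1bar x) ^+ (k - p') *
                         (gm1 x + n%:R * g2bar x) ^+ p')).
  move=> p'k; rewrite -coef_linear_expn -coefZ.
  apply: (coef_from_nat_values _ _ (fun p => 'C(k, p)%:R *
    (\sum_(q' < k.+1) 'C(k, q')%:R * c p q' * n%:R ^+ q')) _ _ _ p'k) => m.
  rewrite -image_tens_power_vec // /L.
  rewrite -!(rmorph_nat (real_complex R)).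
  rewrite (image_power_vec _ _ _ _ I_iso I_00) !hornerE.
  rewrite !(rmorph_nat (real_complex R)).
  by congr (_ * _ ^+ _) => /=; ring.
have C0 j : (j <= k)%N -> 'C(k, j)%:R != 0 :> R[i].
  by move=> jk; rewrite pnatr_eq0 -lt0n bin_gt0.
have cE : 'C(k, p)%:R * ('C(k, q)%:R * c p q) = N * ('C(k, p)%:R *
    (((g2 x)%:P + g1bar x *: 'X) ^+ (k - p) *
     ((gm1 x)%:P + g2bar x *: 'X) ^+ p)`_q).
  rewrite [RHS]mulrA -coefZ.
  apply: (coef_from_nat_values _ k.+1
    (fun q => 'C(k, p)%:R * ('C(k, q)%:R * c p q)) _ _ q q_le_k) => n.
  rewrite !hornerE /=.
  rewrite -!mulrA [g1bar x * _]mulrC [g2bar x * _]mulrC.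
  rewrite -rowE // mulr_sumr.
  by apply: eq_bigr => j _; rewrite !mulrA.
rewrite -coef_two_linear_powers // -[LHS]/(c p q) -[_ * N * _]mulrA -cE.
by field; rewrite !C0.
Qed.
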